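(* Let $f$ be a probability density on $\mathbb{R}$ with cumulative distribution function $F(x)=\int_{-\infty}^x f(t)\,dt$, and suppose $f$ satisfies Poisson summation in the form $\sum_{k\in\mathbb{Z}}f\left(\frac{x+k}{T}\right)=T\sum_{k\in\mathbb{Z}}e^{2\pi i xk}\widehat{f}(Tk)$ for all real $x$ and $T>0$. For each $T>0$ let $Y_T$ be a real-valued random quantity (log-process) with cumulative distribution function $F_T(x)=\mathbb{P}(Y_T\le x)$, and write $F_T(x)=F(x/T)+E_T(x)$. Suppose the family $\{Y_T\}$ is Benford-good (see context). Then for every $[a,b]\subset[0,1]$, $$\lim_{T\to\infty}\mathbb{P}\left(Y_T \bmod 1\in[a,b]\right)=b-a,$$ i.e. $Y_T$ converges to a distribution that is equidistributed modulo $1$.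
   Context: The Fourier transform is $\widehat{f}(y)=\int_{-\infty}^{\infty}f(x)e^{-2\pi i xy}\,dx$. Write $F_T(\infty)=\lim_{x\to\infty}F_T(x)$ and $F_T(-\infty)=\lim_{x\to-\infty}F_T(x)$. The family is called Benford-good if there is a monotone increasing function $h(T)$ with $h(T)\to\infty$ as $T\to\infty$ such that, as $T\to\infty$: (1) (small tails) $F_T(\infty)-F_T(Th(T))=o(1)$ and $F_T(-Th(T))-F_T(-\infty)=o(1)$; (2) (rapid decay of the characteristic function) $S(T)=\sum_{k\neq0}\left|\widehat{f}(Tk)/k\right|=o(1)$; (3) (small truncated translated error) for all $0\le a<b\le1$, $\mathcal{E}_T(a,b)=\sum_{k\in\mathbb{Z},\,|k|\le Th(T)}\left[E_T(b+k)-E_T(a+k)\right]=o(1)$. *)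

(* Defs.v *)
From HB Require Import structures.
From mathcomp Require Import all_boot all_order all_algebra complex.
From mathcomp Require Import all_classical all_reals all_analysis.

Set Implicit Arguments.
Unset Strict Implicit.
Unset Printing Implicit Defensive.

Import Order.TTheory GRing.Theory Num.Theory.
Import numFieldNormedType.Exports.

Local Open Scope classical_set_scope.
Local Open Scope complex_scope.
Local Open Scope ring_scope.

Section Defs.
Context {R : realType}.
Local Notation mu := (@lebesgue_measure R).

Definition is_prob_density (f : R -> R) : Prop :=
  [/\ measurable_fun setT f, (forall x, 0 <= f x)
    & (\int[mu]_x (f x)%:E = 1)%E].

Definition density_cdf (f : R -> R) (x : R) : R :=
  \int[mu]_(t in `]-oo, x]) f t.

Definition expi (t : R) : R[i] := cos t +i* sin t.

Definition Cintegral (g : R -> R[i]) : R[i] :=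
  (\int[mu]_x complex.Re (g x)) +i* (\int[mu]_x complex.Im (g x)).

Definition fourier (f : R -> R) (y : R) : R[i] :=
  Cintegral (fun x => (f x)%:C * expi (- (2 * pi * x * y))).

Definition int_upto (x : R) : set int := [set k : int | `|k|%:~R <= x].

(* A sum over an infinite support would default to 0; the lemma excludes
   this for [zsum_upto]. *)
Lemma finite_int_upto (x : R) : finite_set (int_upto x).
Proof.
apply: (@sub_finite_set _ _
  ((fun n : nat => (n%:Z : int)) @` `I_(Num.truncn x).+1 `|`
   (fun n : nat => (- n%:Z : int)) @` `I_(Num.truncn x).+1)).
  move=> k /= kx.
  have kN : (`|k| < (Num.truncn x).+1)%N.
    rewrite ltnS truncn_ge_nat; last by apply: le_trans kx; rewrite ler0z.
    by rewrite pmulrn abszE.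
  have [k0|k0] := leP 0 k.
    by left; exists `|k|%N => //; rewrite gez0_abs.
  by right; exists `|k|%N => //; rewrite ltz0_abs// opprK.
by rewrite finite_setU; split; apply: finite_image; exact: finite_II.
Qed.

Definition zsum_upto (V : nmodType) (u : int -> V) (x : R) : V :=
  \sum_(k \in int_upto x) u k.

(* Both bilateral series are limits of symmetric partial sums; [^o] selects the
   topology of R[i] given by the complex modulus. *)
Definition poisson_summation (f : R -> R) : Prop :=
  forall x T : R, 0 < T ->
  exists (l : R) (r : R[i]^o),
    [/\ zsum_upto (fun k => f ((x + k%:~R) / T)) n%:R @[n --> \oo] --> l,
        zsum_upto (fun k => (expi (2 * pi * x * k%:~R)
                             * fourier f (T * k%:~R) : R[i]^o)) n%:R
          @[n --> \oo] --> r
      & l%:C = T%:C * r].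

Definition char_sum (f : R -> R) (T : R) : \bar R :=
  \esum_(k in [set k : int | k != 0])
    (ComplexField.Normc.normc (fourier f (T * k%:~R) / k%:~R))%:E.

Definition error_term (f : R -> R) (FT : R -> R -> R) (T x : R) : R :=
  FT T x - density_cdf f (x / T).

Definition truncated_error (f : R -> R) (FT : R -> R -> R) (h : R -> R)
    (a b T : R) : R :=
  zsum_upto (fun k => error_term f FT T (b + k%:~R)
                      - error_term f FT T (a + k%:~R)) (T * h T).

(* [FT T] is the distribution function of Y_T; only T > 0 is relevant, for
   [FT] as well as for [h]. *)
Definition benford_good (f : R -> R) (FT : R -> R -> R) : Prop :=
  exists h : R -> R,
  [/\ (forall S T : R, 0 < S -> S <= T -> h S <= h T)
        /\ h T @[T --> +oo] --> +oo,
      (lim (FT T x @[x --> +oo]) - FT T (T * h T)) @[T --> +oo] --> 0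
        /\ (FT T (- (T * h T)) - lim (FT T x @[x --> -oo])) @[T --> +oo] --> 0,
      char_sum f T @[T --> +oo] --> 0%E
    & forall a b : R, 0 <= a -> a < b -> b <= 1 ->
        truncated_error f FT h a b T @[T --> +oo] --> 0].

Definition mod1 (y : R) : R := y - (Num.floor y)%:~R.

End Defs.

(* Main.v *)
(** A density is, up to a small [L1] error, constant at scale [1 / T], so for
    large [T] the mass that [F (x / T)] puts on the translates [(a + k, b + k]],
    [|k| <= T h(T)], is nearly [b - a] times the mass it puts on
    [(k, k + 1]], and the latter sum telescopes to a quantity tending to [1].
    The smallness of the truncated error transfers this to [Y_T]; taking
    [a = 0], [b = 1] shows that no mass of [Y_T] escapes the truncation, and the
    endpoints of [[a, b]] are controlled by translates of short intervals. *)

Require Import Defs.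
From HB Require Import structures.
From mathcomp Require Import all_boot all_order all_algebra.
From mathcomp Require Import all_classical all_reals all_analysis.
From mathcomp Require Import finmap measurable_realfun ring lra zify.

Set Implicit Arguments.
Unset Strict Implicit.
Unset Printing Implicit Defensive.

Import Order.TTheory GRing.Theory Num.Theory.
Import numFieldNormedType.Exports.

Local Open Scope classical_set_scope.
Local Open Scope ring_scope.

(** * Uniform continuity and telescoping over the integers *)

(** Heine-Cantor, by the near-covering form of compactness. Only [x] is confined to the segment; [y]
    may fall outside it, since [g] is continuous everywhere. *)
Lemma continuous_segment_unif (R : realType) (g : R -> R) (a b e : R) :
  continuous g -> 0 < e ->
  exists2 d : R, 0 < d &
    forall x y, x \in `[a, b] -> `|x - y| < d -> `|g x - g y| <= e.
Proof.
move=> cg e0.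
have /compact_near_coveringP cK := @segment_compact R a b.
have nearP : \forall d \near (0:R)^'+, `[a, b]%classic `<=`
    (fun x => forall y, `|x - y| < d -> `|g x - g y| <= e).
  apply: cK => x _.
  have e20 : 0 < e / 2 by rewrite divr_gt0.
  have /cvgrPdist_le/(_ _ e20)[d /= dpos dP] := cg x.
  (* Halving the radius keeps both [x'] and [y] within [d] of the centre [x]. *)
  exists (ball x (d / 2), [set r | r < d / 2]).
    split; first by apply: nbhsx_ballx; rewrite divr_gt0.
    by apply: nbhs_right_lt; rewrite divr_gt0.
  move=> [x' r] /= [xx' rd] y x'y.
  have h1 : `|g x - g x'| <= e / 2.
    by apply: dP => /=; apply: lt_trans xx' _; lra.
  have h2 : `|g x - g y| <= e / 2.
    apply: dP => /=; rewrite -(subrKA x').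
    move: xx'; rewrite /ball/= => xx'.
    by apply: le_lt_trans (ler_normD _ _) _; lra.
  rewrite -(subrKA (g x)); apply: le_trans (ler_normD _ _) _.
  by rewrite distrC in h1; lra.
near (0 : R)^'+ => d.
exists d; first by near: d; exact: nbhs_right_gt.
move=> x y xab; apply: (near nearP d) => //.
Unshelve. all: by end_near. Qed.

(** With [n] the integer part of [x], the range is [-n, ..., n]; shifting by [n] gives [2n + 1]
    natural indices, so the telescope ends at [n + 1]. *)
Lemma zsum_upto_telescope (R : realType) (V : zmodType) (w : int -> V) (x : R) :
  0 <= x ->
  zsum_upto (fun k => w (k + 1) - w k) x =
  w ((Num.truncn x)%:Z + 1) - w (- (Num.truncn x)%:Z).
Proof.
move=> x0; set n := Num.truncn x.
rewrite /zsum_upto (@reindex_fsbig _ _ _ nat int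
  (fun i : nat => i%:Z - n%:Z) `I_(n + n).+1); last first.
  split.
  - move=> i /=; rewrite /int_upto/= => ilt.
    have : (`|i%:Z - n%:Z| <= n)%N by lia.
    rewrite /n truncn_ge_nat// => /le_trans; apply.
  - by move=> i j _ _ /=; lia.
  - move=> k /=; rewrite /int_upto/= => kx.
    have kn : (`|k| <= n)%N.
      by rewrite /n truncn_ge_nat// pmulrn abszE.
    exists (absz (k + n%:Z : int)) => /=; first by lia.
    by rewrite gez0_abs ?addrK//; lia.
rewrite -(fsbig_ord _ _ (fun i : nat => w (i%:Z - n%:Z + 1) - w (i%:Z - n%:Z))).
rewrite -(big_mkord xpredT
  (fun i : nat => w (i%:Z - n%:Z + 1) - w (i%:Z - n%:Z))).
rewrite (eq_bigr (fun i : nat => w (i.+1%:Z - n%:Z) - w (i%:Z - n%:Z)));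
  last by move=> i _; congr (w _ - _); lia.
rewrite (telescope_sumr (fun i : nat => w (i%:Z - n%:Z)))//.
by congr (w _ - w _); lia.
Qed.

(** * Mass and distribution function of a density *)

(** Monotone convergence along the intervals []-n, n]], which exhaust the line. *)
Lemma density_mass_bounded (R : realType) (f : R -> R) (e : R) :
  is_prob_density f -> 0 < e ->
  exists2 M : R, 0 < M &
    1 - e <= \int[lebesgue_measure]_(x in `]- M, M]) f x.
Proof.
move=> [mf f0 f1] e0.
pose mu := @lebesgue_measure R.
pose I (n : nat) : set R := `](- n%:R), n%:R]%classic.
have bI : \bigcup_n I n = setT.
  rewrite -subTset => x _; exists (Num.truncn `|x|).+1 => //.
  have := truncnS_gt `|x|; rewrite ltr_norml => /andP[x1 /ltW x2].
  by rewrite /I/= in_itv/= x1 x2.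
have /fine_cvgP[] :
    (\int[mu]_(x in I n) (f x)%:E)%E @[n --> \oo] --> (1%:E : \bar R).
  have -> : (1%:E : \bar R) = (\int[mu]_(x in \bigcup_n I n) (f x)%:E)%E.
    by rewrite bI f1.
  apply: ge0_nondecreasing_set_cvg_integral.
  - move=> m n mn; apply/subsetPset; apply: subset_itv;
      by rewrite bnd_simp ?lerN2 ler_nat.
  - by move=> n; exact: measurable_itv.
  - by move=> n; apply/measurable_EFinP; exact: measurable_funS mf.
  - by move=> n x _; rewrite lee_fin.
move=> _ /cvgrPdist_le/(_ _ e0)[n _ nP].
(* The successor makes the bound positive even for [n = 0]. *)
exists n.+1%:R => //.
have := nP n.+1 (leqnSn n) => /=.
rewrite /Rintegral -/(I n.+1) => h.
have := le_trans (ler_norm _) h; rewrite /I/=; lra.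
Qed.

Lemma density_cdfB (R : realType) (g : R -> R) (s t : R) :
  lebesgue_measure.-integrable setT (EFin \o g) -> s <= t ->
  density_cdf g t - density_cdf g s =
  \int[lebesgue_measure]_(x in `]s, t]) g x.
Proof.
move=> ig st; rewrite /density_cdf (@Rintegral_itvB _ _ -oo%O (BRight t))//.
exact: integrableS ig.
Qed.

Lemma prob_density_integrable (R : realType) (f : R -> R) :
  is_prob_density f -> lebesgue_measure.-integrable setT (EFin \o f).
Proof.
move=> [mf f0 f1]; apply/integrableP; split; first exact/measurable_EFinP.
rewrite (_ : integral _ _ _ = 1%E) ?ltry//.
by rewrite -f1; apply: eq_integral => x _ /=; rewrite ger0_norm.
Qed.

(** * Oscillation of a density in [L1] *)

Lemma integrable_restrict (R : realType) (D : set R) (g : R -> R) :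
  measurable D ->
  lebesgue_measure.-integrable D (EFin \o g) ->
  lebesgue_measure.-integrable setT (EFin \o (g \_ D)).
Proof.
move=> mD ig; rewrite -restrict_EFin.
exact: (proj1 (@integrable_mkcond _ (measurableTypeR R) _ _ _ _ mD) ig).
Qed.

(* The constant [c] is a value of a continuous [L1]-approximation of [f], and
   [v] collects the tail of [f], the approximation error and the modulus of
   continuity. *)
Lemma density_oscillation (R : realType) (f : R -> R) (e : R) :
  is_prob_density f -> 0 < e ->
  exists (v : R -> R) (d : R),
    [/\ lebesgue_measure.-integrable setT (EFin \o v), forall x, 0 <= v x,
        \int[lebesgue_measure]_x v x <= e, 0 < d
      & forall s t, t - s <= d ->
          exists c, forall x, x \in `]s, t] -> `|f x - c| <= v x].
Proof.
move=> fP e0; pose mu := @lebesgue_measure R.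
have e30 : 0 < e / 3 by rewrite divr_gt0.
have [mf f0 f1] := fP; have intf := prob_density_integrable fP.
have [M M0 MP] := density_mass_bounded fP e30.
set A := `]- M, M]%classic in MP.
(* The margin of 1 makes room for every interval of length at most 1 that meets [A]. *)
pose K := `[- M - 1, M + 1]%classic.
have mK : @measurable _ (measurableTypeR R) K by exact: measurable_itv.
have mA : @measurable _ (measurableTypeR R) A by exact: measurable_itv.
have muK : mu K = (2 * M + 2)%:E.
  rewrite /mu lebesgue_measure_itv/= lte_fin.
  by rewrite ifT; [rewrite -EFinB; congr (_%:E)|]; lra.
have muKoo : (mu K < +oo)%E by rewrite muK ltry.
have intfK : mu.-integrable K (EFin \o f) by exact: integrableS intf.
have [g_ [cg_ ig_ /fine_cvgP[fg_fin fg_cvg]]] :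
    exists g_ : (R -> R)^nat,
    [/\ forall n, continuous (g_ n),
        forall n, mu.-integrable K (EFin \o g_ n) &
        (\int[mu]_(z in K) `|(f z - g_ n z)%:E|)%E @[n --> \oo] --> 0%E].
  by apply: approximation_continuous_integrable => //; exact: muKoo.
move/cvgrPdist_le : fg_cvg => /(_ _ e30)[n _ /(_ n (leqnn n))/=].
rewrite sub0r normrN.
set g := g_ n => gfn.
have intfg : mu.-integrable K (EFin \o (fun x => `|f x - g x|)).
  exact: (integrable_norm (integrableB mK intfK (ig_ n))).
have gf : \int[mu]_(x in K) `|f x - g x| <= e / 3.
  by apply: le_trans (ler_norm _) _; exact: gfn.
(* Chosen so that the constant [e'] has integral [e / 3] over [K]. *)
pose e' := e / 3 / (2 * M + 2).
have e'0 : 0 < e' by rewrite !divr_gt0//; lra.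
have inte' : mu.-integrable K (EFin \o cst e').
  apply/integrableP; split; first exact: (measurable_cst (e'%:E)).
  rewrite (_ : integral _ _ _ = (\int[mu]_(x in K) cst `|e'%:E| x)%E)//.
  by rewrite integral_cst// [X in (_ * X)%E]muK -EFinM ltry.
have [d' d'0 d'P] := continuous_segment_unif (- M - 1) (M + 1) (cg_ n) e'0.
pose v1 := f \_ (~` A).
pose v2 := (fun x => `|f x - g x| + e') \_ K.
have i1 : mu.-integrable setT (EFin \o v1).
  apply: integrable_restrict; first exact: measurableC.
  apply: integrableS intf => //; exact: measurableC.
have i2' : mu.-integrable K (EFin \o (fun x => `|f x - g x| + e')).
  exact: (integrableD mK intfg inte').
have i2 : mu.-integrable setT (EFin \o v2) by exact: integrable_restrict.
have v10 x : 0 <= v1 x by rewrite /v1 patchE; case: ifP.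
have v20 x : 0 <= v2 x.
  by rewrite /v2 patchE; case: ifP => // _; rewrite addr_ge0// ltW.
(* The bound 1 keeps an interval meeting [A] inside [K]; [d' / 2] yields the strict inequality that
   the modulus of continuity asks for. *)
exists (fun x => v1 x + v2 x), (Num.min 1 (d' / 2)); split.
- exact: (integrableD measurableT i1 i2).
- by move=> x; rewrite addr_ge0.
- rewrite RintegralD//.
  have h1 : \int[mu]_x v1 x <= e / 3.
    have -> : \int[mu]_x v1 x = \int[mu]_(x in ~` A) f x.
      exact/esym/(@Rintegral_mkcond _ (measurableTypeR R)).
    have : \int[mu]_x f x = \int[mu]_(x in A) f x + \int[mu]_(x in ~` A) f x.
      rewrite -Rintegral_setU ?setUv//; first exact: measurableC.
      by apply/disj_setPS; rewrite setICr.
    have -> : \int[mu]_x f x = 1 by exact: (congr1 fine f1).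
    move=> h.
    by rewrite -(lerD2l (\int[mu]_(x in A) f x)) -h -lerBlDr.
  have h2 : \int[mu]_x v2 x <= 2 * (e / 3).
    have -> : \int[mu]_x v2 x = \int[mu]_(x in K) (`|f x - g x| + e').
      exact/esym/(@Rintegral_mkcond _ (measurableTypeR R)).
    rewrite RintegralD// Rintegral_cst// [X in fine X]muK/=.
    have : e' * (2 * M + 2) = e / 3 by rewrite /e' divfK//; lra.
    by move=> ->; rewrite mulrDl mul1r lerD2r.
  apply: le_trans (lerD h1 h2) _; lra.
- by rewrite lt_min ltr01 divr_gt0.
- move=> s t; rewrite le_min => /andP[st1 std].
  (* An interval meeting [A] takes a value of [g] as its constant; on one missing [A], [f] coincides
     with its tail [v1] and the constant 0 suffices. *)
  have [[y [yA yI]]|noA] := pselect (exists y, A y /\ y \in `]s, t]).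
    exists (g t) => x xI.
    have xK : x \in `[- M - 1, M + 1].
      move: yA yI xI; rewrite /A/= !in_itv/=.
      by move=> /andP[? ?] /andP[? ?] /andP[? ?]; apply/andP; split; lra.
    have gxt : `|g x - g t| <= e'.
      apply: d'P => //; move: xI; rewrite in_itv/= => /andP[sx xt].
      rewrite ltr_norml; apply/andP; split; lra.
    have -> : v2 x = `|f x - g x| + e' by rewrite /v2 patchE mem_set.
    rewrite -(subrKA (g x)); apply: le_trans (ler_normD _ _) _.
    by have := v10 x; lra.
  exists 0 => x xI; rewrite subr0 ger0_norm//.
  have -> : v1 x = f x.
    by rewrite /v1 patchE mem_set// => Ax; apply: noA; exists x.
  by rewrite lerDl.
Qed.

(** * Increments of distribution functions *)

Lemma density_cdf_le (R : realType) (v : R -> R) (s t : R) :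
  lebesgue_measure.-integrable setT (EFin \o v) -> (forall x, 0 <= v x) ->
  s <= t -> density_cdf v s <= density_cdf v t.
Proof.
move=> iv v0 st; rewrite -subr_ge0 density_cdfB//.
by apply: Rintegral_ge0 => x _.
Qed.

Lemma density_cdf_ge0 (R : realType) (v : R -> R) (x : R) :
  (forall x, 0 <= v x) -> 0 <= density_cdf v x.
Proof. by move=> v0; apply: Rintegral_ge0. Qed.

Lemma density_cdf_le_total (R : realType) (v : R -> R) (x : R) :
  lebesgue_measure.-integrable setT (EFin \o v) -> (forall x, 0 <= v x) ->
  density_cdf v x <= \int[lebesgue_measure]_t v t.
Proof.
move=> iv v0; rewrite /density_cdf.
have mI : @measurable _ (measurableTypeR R) `]-oo, x]%classic.
  exact: measurable_itv.
rewrite /Rintegral fine_le//.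
- by apply: integrable_fin_num => //; exact: integrableS iv.
- exact: integrable_fin_num.
- apply: ge0_subset_integral => //.
    by case/integrableP : iv.
  by move=> y _; rewrite lee_fin.
Qed.

Lemma cdf_increment_near_linear (R : realType) (f v : R -> R) (c u w : R) :
  lebesgue_measure.-integrable setT (EFin \o f) ->
  lebesgue_measure.-integrable setT (EFin \o v) ->
  u <= w -> (forall x, x \in `]u, w] -> `|f x - c| <= v x) ->
  `|density_cdf f w - density_cdf f u - c * (w - u)| <=
    density_cdf v w - density_cdf v u.
Proof.
move=> intf iv uw fv; rewrite !density_cdfB//.
pose mu := @lebesgue_measure R; pose D := `]u, w]%classic.
have mD : @measurable _ (measurableTypeR R) D by exact: measurable_itv.
have muD : mu D = (w - u)%:E.
  rewrite /mu lebesgue_measure_itv/= lte_fin.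
  have [//|wu] := ltP u w.
  by have -> : u = w; [apply/eqP; rewrite eq_le uw|rewrite subrr].
have ic : mu.-integrable D (EFin \o cst c).
  apply/integrableP; split; first exact: (measurable_cst (c%:E)).
  rewrite (_ : integral _ _ _ = (\int[mu]_(x in D) cst `|c%:E| x)%E)//.
  by rewrite integral_cst// [X in (_ * X)%E]muD -EFinM ltry.
have fD : mu.-integrable D (EFin \o f) by exact: integrableS intf.
have vD : mu.-integrable D (EFin \o v) by exact: integrableS iv.
have ifc : mu.-integrable D (EFin \o (fun x => f x - c)).
  exact: (integrableB mD fD ic).
have -> : c * (w - u) = \int[mu]_(x in D) cst c x.
  by rewrite Rintegral_cst// [X in fine X]muD.
rewrite -RintegralB//.
apply: le_trans (le_normr_Rintegral mD ifc) _.
apply: le_Rintegral => //.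
exact: (integrable_norm ifc).
Qed.

(** Each increment is within an increment of [density_cdf v] of [c] times its length, and [c]
    cancels. The factor 2 adds the error on []s', t']] to that on []s, t]], the latter scaled by a
    ratio of lengths at most 1. *)
Lemma cdf_increment_proportional (R : realType) (f v : R -> R)
    (c s t s' t' : R) :
  lebesgue_measure.-integrable setT (EFin \o f) ->
  lebesgue_measure.-integrable setT (EFin \o v) -> (forall x, 0 <= v x) ->
  s <= s' -> s' <= t' -> t' <= t -> s < t ->
  (forall x, x \in `]s, t] -> `|f x - c| <= v x) ->
  `|density_cdf f t' - density_cdf f s'
    - (t' - s') / (t - s) * (density_cdf f t - density_cdf f s)| <=
    2 * (density_cdf v t - density_cdf v s).
Proof.
move=> intf iv v0 ss' st' tt' st fv.
have h1 := cdf_increment_near_linear intf iv (ltW st) fv.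
have /(cdf_increment_near_linear intf iv st') h2 x :
    x \in `]s', t'] -> `|f x - c| <= v x.
  rewrite in_itv/= => /andP[s'x xt']; apply: fv.
  by rewrite in_itv/= (le_lt_trans ss' s'x) (le_trans xt' tt').
have V1 := density_cdf_le iv v0 ss'.
have V2 := density_cdf_le iv v0 tt'.
set l := (t' - s') / (t - s).
have l0 : 0 <= l by rewrite divr_ge0// subr_ge0// ltW.
have l1 : l <= 1.
  by rewrite ler_pdivrMr ?subr_gt0// mul1r; lra.
have -> : density_cdf f t' - density_cdf f s'
    - l * (density_cdf f t - density_cdf f s) =
  (density_cdf f t' - density_cdf f s' - c * (t' - s'))
  - l * (density_cdf f t - density_cdf f s - c * (t - s)).
  have -> : t' - s' = l * (t - s) by rewrite divfK// subr_eq0 gt_eqF.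
  by ring.
apply: le_trans (ler_normB _ _) _; rewrite normrM (ger0_norm l0).
have : l * `|density_cdf f t - density_cdf f s - c * (t - s)| <=
    `|density_cdf f t - density_cdf f s - c * (t - s)|.
  by rewrite ler_piMl.
move=> h3; apply: le_trans (lerD h2 (le_trans h3 h1)) _.
by lra.
Qed.

(** * Sums over integer translates *)

Lemma zsum_uptoE (R : realType) (V : nmodType) (u : int -> V) (x : R) :
  zsum_upto u x = \sum_(k <- fset_set (int_upto x)) u k.
Proof. exact/fsbig_finite/finite_int_upto. Qed.

(** Increments over full periods abut, so they merge into one increment across the window. *)
Lemma zsum_cdf_increments (R : realType) (g : R -> R) (T x : R) : 0 <= x ->
  zsum_upto (fun k => density_cdf g ((1 + k%:~R) / T)
                      - density_cdf g ((0 + k%:~R) / T)) x =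
  density_cdf g (((Num.truncn x)%:R + 1) / T)
  - density_cdf g (- (Num.truncn x)%:R / T).
Proof.
move=> x0; pose w (k : int) := density_cdf g (k%:~R / T).
transitivity (zsum_upto (fun k => w (k + 1) - w k) x).
  rewrite !zsum_uptoE; apply: eq_bigr => k _.
  by rewrite /w intrD add0r [_%:~R + _]addrC.
by rewrite zsum_upto_telescope// /w intrD mulrNz.
Qed.

(* On each period from [k / T] to [(k + 1) / T] mass is nearly proportional to
   length; the errors add up to at most twice the integral of the oscillation
   bound. *)
Lemma density_zsum_near (R : realType) (f : R -> R) (a b e : R) :
  is_prob_density f -> 0 <= a -> a <= b -> b <= 1 -> 0 < e ->
  exists d M : R, [/\ 0 < d, 0 < M & forall T x : R,
    0 < T -> T^-1 <= d -> 0 <= x -> M * T <= (Num.truncn x)%:R ->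
    `|zsum_upto (fun k => density_cdf f ((b + k%:~R) / T)
                          - density_cdf f ((a + k%:~R) / T)) x - (b - a)| <= e].
Proof.
move=> fP a0 ab b1 e0; pose mu := @lebesgue_measure R.
have e30 : 0 < e / 3 by rewrite divr_gt0.
have [mf f0 f1] := fP; have intf := prob_density_integrable fP.
have [v [d [iv v0 ve d0 vP]]] := density_oscillation fP e30.
have [M M0 MP] := density_mass_bounded fP e30.
exists d, M; split => // T x T0 Td x0 MTx.
set n : R := _%:R in MTx.
have nT : M <= n / T by rewrite ler_pdivlMr.
have n0 : 0 <= n by rewrite ler0n.
have T10 : 0 < T^-1 by rewrite invr_gt0.
pose L (k : int) := density_cdf f ((b + k%:~R) / T)
  - density_cdf f ((a + k%:~R) / T).
pose D g (k : int) := density_cdf g ((1 + k%:~R) / T)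
  - density_cdf g ((0 + k%:~R) / T).
(* A period has length [1 / T <= d], so [f] is nearly constant on it; the ratio of lengths is
   [b - a]. *)
have term k : `|L k - (b - a) * D f k| <= 2 * D v k.
  have [|c cP] := vP ((0 + k%:~R) / T) ((1 + k%:~R) / T).
    by rewrite -mulrBl; move: Td; lra.
  have -> : b - a = ((b + k%:~R) / T - (a + k%:~R) / T)
      / ((1 + k%:~R) / T - (0 + k%:~R) / T).
    by field; rewrite lt0r_neq0//= addrK oner_eq0.
  apply: (cdf_increment_proportional intf iv v0 _ _ _ _ cP);
    by rewrite ?ler_pM2r ?ltr_pM2r//; lra.
have sums : `|zsum_upto L x - (b - a) * zsum_upto (D f) x|
    <= 2 * zsum_upto (D v) x.
  rewrite !zsum_uptoE !mulr_sumr -sumrB.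
  apply: le_trans (ler_norm_sum _ _ _) _.
  by apply: ler_sum => k _; exact: term.
have sv : zsum_upto (D v) x <= e / 3.
  rewrite zsum_cdf_increments//; apply: le_trans ve.
  have := density_cdf_le_total (((Num.truncn x)%:R + 1) / T) iv v0.
  have := density_cdf_ge0 (- (Num.truncn x)%:R / T) v0.
  by lra.
have sf1 : zsum_upto (D f) x <= 1.
  rewrite zsum_cdf_increments//.
  have := density_cdf_le_total (((Num.truncn x)%:R + 1) / T) intf f0.
  have := density_cdf_ge0 (- (Num.truncn x)%:R / T) f0.
  have -> : \int[mu]_t f t = 1 by exact: (congr1 fine f1).
  by lra.
(* By [M * T <= n] the telescoped window contains []-M, M]]. *)
have sf2 : 1 - e / 3 <= zsum_upto (D f) x.
  rewrite zsum_cdf_increments// -/n.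
  have /(density_cdf_le intf f0) : M <= (n + 1) / T.
    by rewrite mulrDl mul1r; lra.
  have /(density_cdf_le intf f0) : - n / T <= - M by rewrite mulNr lerN2.
  have : density_cdf f M - density_cdf f (- M) = \int[mu]_(t in `]- M, M]) f t.
    by apply: density_cdfB => //; lra.
  by move: MP; lra.
(* The first difference costs at most [2 * (e / 3)], the second at most [e / 3]. *)
have -> : zsum_upto L x - (b - a) =
    (zsum_upto L x - (b - a) * zsum_upto (D f) x)
    - (b - a) * (1 - zsum_upto (D f) x) by ring.
apply: le_trans (ler_normB _ _) _.
have h : `|(b - a) * (1 - zsum_upto (D f) x)| <= e / 3.
  rewrite ger0_norm ?mulr_ge0 ?subr_ge0//.
  have : (b - a) * (1 - zsum_upto (D f) x) <= 1 - zsum_upto (D f) x.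
    by apply: ler_piMl; lra.
  by lra.
apply: le_trans (lerD sums h) _.
by lra.
Qed.

(** Rescaled by [1 / T], the window eventually covers [[-M, M]]. Asking for [h T >= M + 1] leaves a
    spare [T >= 1] that pays for rounding down. *)
Lemma truncn_mul_near_ge (R : realType) (h : R -> R) (M : R) :
  h T @[T --> +oo] --> +oo ->
  \forall T \near +oo, 0 <= T * h T /\ M * T <= (Num.truncn (T * h T))%:R.
Proof.
move=> hy.
near=> T.
have T1 : 1 <= T by near: T; apply: nbhs_pinfty_ge; rewrite num_real.
have h0 : 0 <= h T by near: T; move/cvgryPge : hy; exact.
have hM : M + 1 <= h T by near: T; move/cvgryPge : hy; exact.
have Th0 : 0 <= T * h T by rewrite mulr_ge0//; lra.
split => //.
have := truncnS_gt (T * h T); rewrite -natr1.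
have : T * (M + 1) <= T * h T by rewrite ler_wpM2l//; lra.
by lra.
Unshelve. all: by end_near. Qed.

Lemma density_zsum_cvg (R : realType) (f h : R -> R) (a b : R) :
  is_prob_density f -> h T @[T --> +oo] --> +oo ->
  0 <= a -> a <= b -> b <= 1 ->
  zsum_upto (fun k => density_cdf f ((b + k%:~R) / T)
                      - density_cdf f ((a + k%:~R) / T)) (T * h T)
    @[T --> +oo] --> b - a.
Proof.
move=> fP hy a0 ab b1; apply/cvgrPdist_le => e e0.
have [d [M [d0 M0 dMP]]] := density_zsum_near fP a0 ab b1 e0.
near=> T.
have T0 : 0 < T by near: T; apply: nbhs_pinfty_gt; rewrite num_real.
have [Th0 MT] : 0 <= T * h T /\ M * T <= (Num.truncn (T * h T))%:R.
  by near: T; exact: truncn_mul_near_ge.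
have dT : d^-1 <= T by near: T; apply: nbhs_pinfty_ge; rewrite num_real.
rewrite distrC; apply: dMP => //.
by rewrite -(invrK d) lef_pV2 ?posrE ?invr_gt0//.
Unshelve. all: by end_near. Qed.

(** * Translated intervals and reduction modulo 1 *)

(** Truncated counterpart of the event that [y] lies in []a, b]] modulo 1. Half-open translates have
    as probability a difference of two values of the distribution function. *)
Definition shifted_itv (R : realType) (a b x : R) : set R :=
  \bigcup_(k in int_upto x) `]a + k%:~R, b + k%:~R]%classic.

Lemma measurable_shifted_itv (R : realType) (a b x : R) :
  measurable (shifted_itv a b x).
Proof.
apply: fin_bigcup_measurable; first exact: finite_int_upto.
by move=> k _; exact: measurable_itv.
Qed.

Lemma mod1_in (R : realType) (y : R) (k : int) :
  k%:~R <= y < k%:~R + 1 -> mod1 y = y - k%:~R.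
Proof. by move=> yk; rewrite /mod1 (@floor_def _ _ k)// intrD. Qed.

Lemma measurable_mod1_itv (R : realType) (a b : R) :
  measurable [set y : R | mod1 y \in `[a, b]].
Proof.
rewrite (_ : [set y | _] = \bigcup_(k in [set: int])
   (`[a + k%:~R, b + k%:~R] `&` `[k%:~R, k%:~R + 1[)%classic); last first.
  apply/seteqP; split => [y /=|y [k _ /= []]].
    rewrite /mod1 in_itv/= => /andP[h1 h2]; exists (Num.floor y) => //=.
    split; rewrite in_itv/=; first by apply/andP; split; lra.
    by rewrite floor_le_tmp /= -intrD1 floorD1_gt.
  rewrite !in_itv/= => /andP[h1 h2] /mod1_in ->.
  by apply/andP; split; lra.
apply: countable_bigcupT_measurable => // k.
by apply: measurableI; exact: measurable_itv.
Qed.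

Lemma fine_probability_le (d : measure_display) (T : measurableType d)
    (R : realType) (nu : probability T R) (A B : set T) :
  measurable A -> measurable B -> A `<=` B -> fine (nu A) <= fine (nu B).
Proof.
move=> mA mB AB; rewrite fine_le ?fin_num_measure//.
by apply: le_measure => //; exact/mem_set.
Qed.

Lemma fine_probabilityU (d : measure_display) (T : measurableType d)
    (R : realType) (nu : probability T R) (A B : set T) :
  measurable A -> measurable B ->
  fine (nu (A `|` B)) <= fine (nu A) + fine (nu B).
Proof.
move=> mA mB; rewrite -fineD ?fin_num_measure// fine_le//.
- by rewrite fin_num_measure//; exact: measurableU.
- by rewrite fin_numD !fin_num_measure.
- exact: measureU2.
Qed.

(** As [0 <= a] and [b <= 1], each translate lies in its own []k, k + 1]], so the translates are
    disjoint and their probabilities add up. *)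
Lemma probability_shifted_itv (R : realType) (nu : probability R R)
    (a b x : R) : 0 <= a -> a <= b -> b <= 1 ->
  fine (nu (shifted_itv a b x)) =
  zsum_upto (fun k => fine (nu `]-oo, b + k%:~R]%classic)
                      - fine (nu `]-oo, a + k%:~R]%classic)) x.
Proof.
move=> a0 ab b1.
rewrite /shifted_itv measure_fin_bigcup; last 3 first.
- exact: finite_int_upto.
- apply/trivIsetP => k l _ _ kl; apply/seteqP; split => // y [/=].
  rewrite !in_itv/= => /andP[k1 k2] /andP[l1 l2]; apply/negP: kl.
  rewrite negbK eq_le -!ltzD1 -!(ltr_int R) !intrD.
  by apply/andP; split; lra.
- by move=> k _; exact: measurable_itv.
rewrite /zsum_upto -[RHS]/(fine _%:E) -fsumEFin; last exact: finite_int_upto.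
congr fine; apply: eq_fsbigr => k _.
rewrite (_ : `]a + k%:~R, b + k%:~R]%classic =
  `]-oo, b + k%:~R]%classic `\` `]-oo, a + k%:~R]%classic); last first.
  apply/seteqP; split => [y /=|y [/=]]; rewrite !in_itv/=.
    by move=> /andP[h1 h2]; split => //; apply/negP; rewrite -ltNge.
  by move=> h1 /negP; rewrite -ltNge => ->.
rewrite measureD ?EFinB ?fineK ?fin_num_measure//; last first.
  by rewrite -ge0_fin_numE// fin_num_measure.
congr (_ - nu _)%E; apply/seteqP; split => [y [//]|y /= ya]; split => //.
by move: ya; rewrite /= !in_itv/=; lra.
Qed.

(* The endpoints [a] and [1 = 0 mod 1], which the half-open translates treat
   differently from [mod1], are absorbed by translates of length [e]. *)
Lemma shifted_itv_sub_mod1 (R : realType) (a b e x : R) :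
  0 <= a -> b <= 1 -> 0 < e ->
  shifted_itv a b x `<=`
  [set y | mod1 y \in `[a, b]] `|` shifted_itv (1 - e) 1 x.
Proof.
move=> a0 b1 e0 y [k kx /=]; rewrite in_itv/= => /andP[ky yk].
(* Since [b <= 1], the second case is [y = k + 1], whose residue is 0. *)
have [yk1|yk1] := ltP y (k%:~R + 1).
  left; rewrite /= (@mod1_in _ _ k); first by rewrite in_itv/=; lra.
  by rewrite yk1 andbT; lra.
right; exists k => //=; rewrite in_itv/=; lra.
Qed.

(** The four pieces catch, in order, points outside the window, residues in []a, b]], the residue
    [a] itself, and integers. The maximum with 0 keeps the third piece within one period. *)
Lemma mod1_sub_shifted_itv (R : realType) (a b e x : R) : 0 <= a -> 0 < e ->
  [set y | mod1 y \in `[a, b]] `<=`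
  (~` shifted_itv 0 1 x `|` shifted_itv a b x) `|`
  (shifted_itv (Num.max 0 (a - e)) a x `|` shifted_itv (1 - e) 1 x).
Proof.
move=> a0 e0 y /= yab.
have [[k kx /=]|?] := pselect (shifted_itv 0 1 x y); last by left; left.
rewrite in_itv/= => /andP[ky yk].
have [yk1|yk1] := ltP y (k%:~R + 1); last first.
  by right; right; exists k => //=; rewrite in_itv/=; lra.
move: yab; rewrite (@mod1_in _ _ k); last by rewrite yk1 andbT; lra.
rewrite in_itv/= => /andP[h1 h2].
have [ay|ya] := ltP a (y - k%:~R).
  by left; right; exists k => //=; rewrite in_itv/=; lra.
right; left; exists k => //=; rewrite in_itv/=; apply/andP; split; last lra.
by rewrite -ltrBrDr gt_max; apply/andP; split; lra.
Qed.

(** The two inclusions squeeze the probability: the complement of [shifted_itv 0 1] has probability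
    tending to 0, and the short translates have limits at most [e]. *)
Lemma mod1_cvg (R : realType) (nu : R -> probability R R) (x : R -> R) :
  (forall a b : R, 0 <= a -> a <= b -> b <= 1 ->
    fine (nu T (shifted_itv a b (x T))) @[T --> +oo] --> b - a) ->
  forall a b : R, 0 <= a -> a <= b -> b <= 1 ->
    fine (nu T [set y | mod1 y \in `[a, b]]) @[T --> +oo] --> b - a.
Proof.
move=> nucvg a b a0 ab b1; apply/cvgrPdist_le => eps eps0.
(* The upper estimate uses four probabilities, each off by at most [eps / 8], and two lengths at
   most [e]; the bound 1 ensures [0 <= 1 - e]. *)
pose e := Num.min 1 (eps / 8).
have e0 : 0 < e by rewrite lt_min ltr01 divr_gt0.
have e1 : e <= 1 by rewrite ge_min lexx.
have e8 : e <= eps / 8 by rewrite ge_min lexx orbT.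
have eps8 : 0 < eps / 8 by rewrite divr_gt0.
pose a' := Num.max 0 (a - e).
have a'0 : 0 <= a' by rewrite le_max lexx.
have a'a : a' <= a by rewrite ge_max a0 lerBlDr lerDl ltW.
have a'e : a - a' <= e by rewrite lerBlDr addrC -lerBlDr le_max lexx orbT.
have nearU u v : 0 <= u -> u <= v -> v <= 1 ->
    \forall T \near +oo,
      `|v - u - fine (nu T (shifted_itv u v (x T)))| <= eps / 8.
  by move=> u0 uv v1; have /cvgrPdist_le/(_ _ eps8) := nucvg u v u0 uv v1.
have e10 : 0 <= 1 - e by lra.
have e11 : 1 - e <= 1 by lra.
near=> T.
have /ler_normlP[ab1 ab2] :
    `|b - a - fine (nu T (shifted_itv a b (x T)))| <= eps / 8.
  by near: T; exact: nearU.
have /ler_normlP[t1 t2] :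
    `|1 - (1 - e) - fine (nu T (shifted_itv (1 - e) 1 (x T)))| <= eps / 8.
  by near: T; exact: nearU.
have /ler_normlP[w1 w2] :
    `|1 - 0 - fine (nu T (shifted_itv 0 1 (x T)))| <= eps / 8.
  by near: T; exact: nearU.
have /ler_normlP[l1 l2] :
    `|a - a' - fine (nu T (shifted_itv a' a (x T)))| <= eps / 8.
  by near: T; apply: nearU => //; exact: le_trans b1.
have mU u v := measurable_shifted_itv u v (x T).
have mS := measurable_mod1_itv a b.
have lower : fine (nu T (shifted_itv a b (x T))) <=
    fine (nu T [set y | mod1 y \in `[a, b]])
    + fine (nu T (shifted_itv (1 - e) 1 (x T))).
  apply: le_trans (fine_probabilityU _ mS (mU _ _)).
  apply: fine_probability_le => //; first exact: measurableU.
  exact: shifted_itv_sub_mod1.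
have upper : fine (nu T [set y | mod1 y \in `[a, b]]) <=
    (1 - fine (nu T (shifted_itv 0 1 (x T)))
     + fine (nu T (shifted_itv a b (x T))))
    + (fine (nu T (shifted_itv a' a (x T)))
       + fine (nu T (shifted_itv (1 - e) 1 (x T)))).
  have mC := measurableC (mU 0 1).
  have -> : 1 - fine (nu T (shifted_itv 0 1 (x T))) =
      fine (nu T (~` shifted_itv 0 1 (x T))).
    by rewrite probability_setC// fineB// fin_num_measure.
  apply: le_trans (lerD (fine_probabilityU _ mC (mU a b))
                        (fine_probabilityU _ (mU a' a) (mU (1 - e) 1))).
  have mL := measurableU _ _ mC (mU a b).
  have mR := measurableU _ _ (mU a' a) (mU (1 - e) 1).
  apply: le_trans (fine_probabilityU _ mL mR).
  apply: fine_probability_le => //; first exact: measurableU.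
  exact: mod1_sub_shifted_itv.
by rewrite ler_norml; apply/andP; split; lra.
Unshelve. all: by end_near. Qed.

(** * Equidistribution of [Y T] modulo 1 *)

Unset Implicit Arguments.

Theorem theorem3p5 (R : realType) (f : R -> R)
    (d : R -> measure_display) (Omega : forall T : R, measurableType (d T))
    (P : forall T : R, probability (Omega T) R)
    (Y : forall T : R, {RV (P T) >-> R}) :
  is_prob_density f ->
  poisson_summation f ->
  benford_good f (fun T x => fine (cdf (Y T) x)) ->
  forall a b : R, 0 <= a -> a <= b -> b <= 1 ->
    P T (Y T @^-1` [set y | mod1 y \in `[a, b]]) @[T --> +oo] --> (b - a)%:E.
Proof.
move=> fP _ [h [[_ hy] _ _ errh]] a b a0 ab b1.
(* Passing to laws on the line removes the dependence of the sample space on [T]. *)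
pose nu T : probability R R := distribution (P T) (Y T).
apply/fine_cvgP; split.
  apply: nearW => T; rewrite fin_num_measure//.
  exact: (measurable_funPTI (Y T) (measurable_mod1_itv a b)).
apply: (mod1_cvg (nu := nu) (x := fun T => T * h T)) => //.
move=> {a b a0 ab b1} a b a0 ab b1.
(* The truncated error is controlled for [a < b] only; for [a = b] the translates are empty. *)
have [->|anb] := eqVneq a b.
  rewrite subrr (_ : (fun T => _) = cst 0); first exact: cvg_cst.
  apply/funext => T /=; rewrite (_ : shifted_itv _ _ _ = set0) ?measure0//.
  by apply/seteqP; split => // y [k _ /=]; rewrite in_itv/=; lra.
have ab' : a < b by rewrite lt_neqAle anb.
(* Termwise, the increment of [F (x / T)] plus that of the error is the increment of the
   distribution function of [Y T]. *)
have H := cvgD (density_zsum_cvg fP hy a0 ab b1) (errh a b a0 ab' b1).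
rewrite addr0 in H; apply: cvg_trans; last exact: H.
apply: near_eq_cvg; apply: nearW => T /=.
rewrite probability_shifted_itv// fctE /truncated_error !zsum_uptoE.
rewrite -big_split/=.
by apply: eq_bigr => k _; rewrite /error_term /nu /cdf; ring.
Qed.
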